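(* There exists an absolute constant $c>0$ such that the following holds. Let $X$ be a finite set, let $0<p<1$, let $n$ be a positive integer, let $r>0$, let $\Lambda\subseteq\mathbb R_{\ge0}^X$, and let $\Lambda_0$ be a finite subset of $\Lambda$. Suppose that there are sets $C_\lambda\subseteq X$ ($\lambda\in\Lambda_0$) with $|C_\lambda|\le n$, such that $|\Lambda_0|\ge p^{-n}$ and $\lambda(C_\lambda\setminus C_{\lambda'})\ge r$ for all distinct $\lambda,\lambda'\in\Lambda_0$. Then \[ \mathbb E\, Z_\Lambda(X_p)\ge c\,r . \]
   Context: For $\lambda\in\mathbb R_{\ge0}^X$ and $W\subseteq X$, $\lambda(W)=\sum_{x\in W}\lambda(x)$. For $A\subseteq X$, $Z_\Lambda(A)=\sup_{\lambda\in\Lambda}\lambda(A)$ (possibly $+\infty$). $X_p$ denotes the random subset of $X$ containing each element independently with probability $p$. *)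

(* Defs.v *)
From mathcomp Require Import all_boot all_order all_algebra finmap.
From mathcomp Require Import boolp classical_sets reals constructive_ereal ereal.

Set Implicit Arguments.
Unset Strict Implicit.
Unset Printing Implicit Defensive.

Import Order.TTheory GRing.Theory Num.Theory.

Local Open Scope ring_scope.

Section RandomSubset.
Variables (R : realType) (X : finType).

Definition weight (l : {ffun X -> R}) (W : {set X}) : R :=
  \sum_(x in W) l x.

(* Valued in the extended reals: the supremum may be +oo. *)
Definition Z (Lambda : set {ffun X -> R}) (A : {set X}) : \bar R :=
  ereal_sup [set (weight l A)%:E | l in Lambda]%classic.

(* P(X_p = A): the membership events are independent of probability p. *)
Definition Xp_mass (p : R) (A : {set X}) : R :=
  \prod_(x : X) (if x \in A then p else 1 - p).

(* E f(X_p). *)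
Definition Xp_expectation (p : R) (f : {set X} -> \bar R) : \bar R :=
  (\sum_(A : {set X}) (Xp_mass p A)%:E * f A)%E.

End RandomSubset.

(* Main.v *)
(* Among the sets S contained in at least two of the C_l, choose one maximizing
   p^-|S| times the number of C_l containing it. The sets D_l = C_l \ S, for
   the l with S inside C_l, are then p-spread (at most a proportion p^|T| of
   them contains a given T), and l(D_l) >= r by separation.

   Let q = 12 p and W = X_q. Sort each D_l by decreasing l. If W contains at
   least half of every prefix of some D_l, then l(W) >= r / 2. Otherwise, for
   each index j take the smallest T inside D_j \ W such that, for some l and
   t = |T|, W u T misses at most k/2 - t of the first k points of D_l for every
   k. By minimality T lies among the first 2t points of D_l, because removing
   one later point of T lowers both t and the quality of the capture by one.
   Thus (W u T, t) leaves at most 4^t choices for T, spreadness leaves a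
   proportion p^t of choices for j, and replacing W by W u T costs q^-t. The
   bad W have probability at most the sum over t >= 1 of (4p/q)^t, i.e. 1/2.

   Finally X_p is a thinning of X_q, so E Z(X_p) >= (p/q) E Z(X_q). *)

Require Import Defs.
From mathcomp Require Import all_boot all_order all_algebra finmap.
From mathcomp Require Import boolp classical_sets reals constructive_ereal ereal.
From mathcomp Require Import zify ring lra.

Set Implicit Arguments.
Unset Strict Implicit.
Unset Printing Implicit Defensive.

Import Order.TTheory GRing.Theory Num.Theory.

Local Open Scope ring_scope.

(** * Captured sequences and minimal completing sets *)

(* At most [(k - 2 t) / 2] of the first [k] entries of [s] are missed by [Z];
   the subtraction is truncated, so the first [2 t] entries all lie in [Z]. *)
Definition captures (X : finType) (s : seq X) (Z : {set X}) (t : nat) : bool :=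
  [forall k : 'I_(size s).+1,
    (count (fun x => x \notin Z) (take k s)).*2 <= k - t.*2]%N.

Lemma capturesP (X : finType) (s : seq X) (Z : {set X}) (t : nat) :
  reflect (forall k : nat,
      (count (fun x => x \notin Z) (take k s)).*2 <= k - t.*2)%N
    (captures s Z t).
Proof.
apply: (iffP forallP) => [H k|H k]; last exact: H.
case: (leqP k (size s)) => hk; first by have := H (Ordinal (n := (size s).+1) hk).
have := H ord_max; rewrite /= take_size take_oversize ?(ltnW hk) //; lia.
Qed.

(** Prefixes of length at most [2 t] do not see [x]. On longer ones the doubled number of misses
    grows by at most 2, exactly the gain in [k - 2 t] when [t] drops by one. *)
Lemma captures_setD1 (X : finType) (s : seq X) (Z : {set X}) (t : nat) (x : X) :
  uniq s -> (0 < t)%N -> x \notin take t.*2 s -> captures s Z t ->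
  captures s (Z :\ x) t.-1.
Proof.
move=> us t_gt0 xs /capturesP H; apply/capturesP => k; have Hk := H k.
case: (leqP k t.*2) => hk.
  rewrite (@eq_in_count _ _ (fun x => x \notin Z)).
    by apply: leq_trans Hk _; lia.
  move=> y ys; rewrite in_setD1; case: eqVneq => [yx|//]; exfalso.
  by move: xs; rewrite -yx -(cat_take_drop k (take _ s)) mem_cat take_takel // ys.
have : (count (fun y => y \notin Z :\ x) (take k s) <=
        count (predU (fun y => y \notin Z) (pred1 x)) (take k s))%N.
  by apply: sub_count => y /=; rewrite in_setD1 negb_and negbK orbC.
have := count_predUI (fun y => y \notin Z) (pred1 x) (take k s).
have : (count_mem x (take k s) <= 1)%N by rewrite count_uniq_mem ?take_uniq ?leq_b1.
move: Hk; set c := count _ _; set c1 := count _ _; set c2 := count _ _; 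
  set c3 := count _ _; set c4 := count _ _.
lia.
Qed.

(* Depends on [Z] and [t] only: any index whose sequence is captured will do. *)
Definition decode (X I : finType) (J : {set I}) (s : I -> seq X) (Z : {set X})
    (t : nat) : {set X} :=
  if [pick i in J | captures (s i) Z t] is Some i
  then [set x in take t.*2 (s i)] else finset.set0.

Lemma card_decode (X I : finType) (J : {set I}) (s : I -> seq X) (Z : {set X})
    (t : nat) : (#|decode J s Z t| <= t.*2)%N.
Proof.
rewrite /decode; case: pickP => [i _|_]; last by rewrite cards0.
by rewrite cardsE (leq_trans (card_size _)) // size_take_min geq_minl.
Qed.

(* [T] is a smallest set making [W :|: T] capture some sequence. *)
Lemma fragment_exists (X I : finType) (J : {set I}) (s : I -> seq X)
    (W : {set X}) (j : I) :
  (forall i, uniq (s i)) -> j \in J ->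
  exists T : {set X},
    [/\ T \subset [set x in s j], [disjoint T & W],
        T \subset decode J s (W :|: T) #|T| &
        exists2 i, i \in J & captures (s i) (W :|: T) #|T|].
Proof.
move=> us jJ.
pose P (T : {set X}) := (T \subset [set x in s j] :\: W) &&
  [exists i in J, captures (s i) (W :|: T) #|T|].
(* Adding all of [s j] leaves no miss, so truncated subtraction makes the capture hold for every
   [t]. *)
have P0 : P ([set x in s j] :\: W).
  rewrite /P subxx; apply/exists_inP; exists j => //; apply/capturesP => k.
  rewrite (@eq_in_count _ _ pred0) ?count_pred0 // => x /mem_take xs.
  by rewrite !inE xs andbT orbN.
case: (arg_minnP (fun T : {set X} => #|T|) P0) => T /andP[TsD exT] minT.
have /andP[TD WT] : (T \subset [set x in s j]) && [disjoint T & W].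
  by rewrite -finset.subsetD.
exists T; split => //; last by have /exists_inP := exT.
apply/fintype.subsetP => x xT; rewrite /decode; case: pickP => [i /andP[iJ ci]|no]; last first.
  by have /exists_inP[i iJ ci] := exT; have := no i; rewrite /= iJ ci.
rewrite inE; apply: contraT => xs.
have cT : #|T| = #|T :\ x|.+1 by rewrite (cardsD1 x T) xT.
suff /minT : P (T :\ x) by rewrite cT ltnn.
rewrite /P (fintype.subset_trans _ TsD) ?finset.subD1set //=; apply/exists_inP; exists i => //.
have xW : x \notin W by rewrite (disjointFr WT).
have -> : W :|: T :\ x = (W :|: T) :\ x.
  apply/finset.setP => y; rewrite !inE; case: eqVneq => [->|//] /=.
  by rewrite (negbTE xW).
have -> : #|T :\ x| = #|T|.-1 by rewrite cT.
by apply: captures_setD1 => //; rewrite cT.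
Qed.

(** * From prefix counts to weights *)

(** Abel summation, by induction on the last entry. The bound [a] is left free so that the induction
    hypothesis can be used with [a := l x] for the new, smallest value. *)
Lemma pairwise_sum_prefix_ge (R : realDomainType) (T : eqType) (l e : T -> R)
    (s : seq T) :
  pairwise (fun x y => l y <= l x) s ->
  (forall k, 0 <= \sum_(x <- take k s) e x) ->
  forall a, (forall x, x \in s -> a <= l x) ->
  a * (\sum_(x <- s) e x) <= \sum_(x <- s) e x * l x.
Proof.
elim/last_ind: s => [_ _ a _|s x IH]; first by rewrite !big_nil mulr0.
rewrite pairwise_rcons => /andP[/allP ls ps] pos a al.
have pos' k : 0 <= \sum_(y <- take k s) e y.
  have := pos (minn k (size s)); rewrite -cats1 take_cat.
  case: ltnP => [h|h]; first by rewrite take_min take_size.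
  have -> : (minn k (size s) - size s = 0)%N by lia.
  rewrite take0 cats0 => h2; case: (leqP (size s) k) => hk.
    by rewrite take_oversize.
  by move: h; rewrite (minn_idPl (ltnW hk)) leqNgt hk.
have E : 0 <= \sum_(y <- rcons s x) e y.
  by have := pos (size (rcons s x)); rewrite take_size.
have h1 := IH ps pos' (l x) ls.
have h2 : a <= l x by apply: al; rewrite mem_rcons mem_head.
have h3 := ler_wpM2r E h2.
move: h1 h3; rewrite -!cats1 !big_cat !big_seq1 /=; lra.
Qed.

(** Give hits sign [1] and misses sign [-1]. Capture with [t = 0] makes all prefix sums nonnegative,
    so by Abel summation the hits weigh at least as much as the misses. *)
Lemma captures0_weight (R : realType) (X : finType) (l : {ffun X -> R})
    (s : seq X) (Z : {set X}) :
  (forall x, 0 <= l x) -> uniq s -> pairwise (fun x y => l y <= l x) s ->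
  captures s Z 0 -> weight l [set x in s] <= 2 * weight l Z.
Proof.
move=> l0 us ps /capturesP H.
pose e x : R := if x \in Z then 1 else -1.
have pos k : 0 <= \sum_(x <- take k s) e x.
  have -> : \sum_(x <- take k s) e x = (size (take k s))%:R -
      (count (fun x => x \notin Z) (take k s)).*2%:R.
    elim: (take k s) => [|x u IH]; first by rewrite big_nil subrr.
    rewrite big_cons IH /e /=; case: (x \in Z) => /=;
      rewrite -?muln2 !(natrD, natrM, mulrS); lra.
  rewrite subr_ge0 ler_nat; have := H (size (take k s)).
  by rewrite subn0 size_take_min take_min take_size; case: leqP.
have := pairwise_sum_prefix_ge ps pos (fun x _ => l0 x).
rewrite mul0r => h.
have hs (F : X -> R) : \sum_(x in [set x in s]) F x = \sum_(x <- s) F x.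
  by rewrite [RHS]big_uniq //; apply: eq_bigl => x; rewrite inE.
rewrite /weight hs.
have h2 : \sum_(x <- s | x \in Z) l x <= \sum_(x in Z) l x.
  rewrite big_mkcond -hs /= [leRHS]big_mkcond [leLHS]big_mkcond /=.
  by apply: ler_sum => x _; case: ifP => _; case: ifP.
have h3 : \sum_(x <- s) l x + \sum_(x <- s) e x * l x =
    2 * \sum_(x <- s | x \in Z) l x.
  rewrite -big_split /= [in RHS]big_mkcond /= mulr_sumr.
  by apply: eq_bigr => x _; rewrite /e; case: ifP => _; ring.
lra.
Qed.

(** * The product measure and thinning *)

Lemma Xp_mass_ge0 (R : realType) (X : finType) (p : R) (A : {set X}) :
  0 <= p -> p <= 1 -> 0 <= Xp_mass p A.
Proof.
by move=> p0 p1; apply: prodr_ge0 => x _; case: ifP => // _; rewrite subr_ge0.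
Qed.

Lemma sum_Xp_mass (R : realType) (X : finType) (p : R) :
  \sum_(A : {set X}) Xp_mass p A = 1.
Proof.
transitivity (\prod_(x : X) (p + (1 - p))); last first.
  by apply: big1 => x _; rewrite addrC subrK.
by rewrite bigA_distr.
Qed.

(** Replacing [G x] by 0 in the expanded product kills exactly the sets that miss [x]. *)
Lemma sum_prod_setI (R : comNzRingType) (X : finType) (F G : X -> R) (x : X) :
  \sum_(A : {set X} | x \in A) \prod_y (if y \in A then F y else G y) =
  F x * \prod_(y | y != x) (F y + G y).
Proof.
pose G' y := if y == x then 0 else G y.
have -> : F x * \prod_(y | y != x) (F y + G y) = \prod_y (F y + G' y).
  rewrite [RHS](bigD1 x) //= /G' eqxx addr0; congr (_ * _).
  by apply: eq_bigr => y /negbTE ->.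
rewrite bigA_distr big_mkcond /=; apply: eq_bigr => A _.
case: ifPn => xA.
  apply: eq_bigr => y _; case: ifPn => // yA; rewrite /G'.
  by case: eqVneq yA => // ->; rewrite xA.
by rewrite (bigD1 x) //= (negbTE xA) /G' eqxx mul0r.
Qed.

(* Thinning [X_q] by the ratio [s] produces [X_(q s)], and conditionally on
   [X_q = W] the expected weight of the thinned set is [s * weight l W]. *)
Lemma thinning (R : realType) (X : finType) (q s : R) (f g : {set X} -> R) :
  0 <= q -> q <= 1 -> 0 <= s -> s <= 1 ->
  (forall W, exists2 l : {ffun X -> R},
     (forall A, weight l A <= f A) & g W <= weight l W) ->
  s * (\sum_W Xp_mass q W * g W) <= \sum_A Xp_mass (q * s) A * f A.
Proof.
move=> q0 q1 s0 s1 H.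
pose F (W : {set X}) x := if x \in W then q * s else 0.
pose G (W : {set X}) x := if x \in W then q * (1 - s) else 1 - q.
(* Joint mass of [X_q = W] and its thinning being [A]; it vanishes unless [A] lies in [W]. *)
pose K (W A : {set X}) := \prod_x (if x \in A then F W x else G W x).
have K0 W A : 0 <= K W A.
  apply: prodr_ge0 => x _; rewrite /F /G.
  by case: (x \in A); case: (x \in W); rewrite ?mulr_ge0 ?subr_ge0.
have KA A : Xp_mass (q * s) A = \sum_W K W A.
  pose F1 x := if x \in A then q * s else q * (1 - s).
  pose G1 x := if x \in A then 0 else 1 - q.
  transitivity (\prod_x (F1 x + G1 x)).
    by apply: eq_bigr => x _; rewrite /F1 /G1; case: ifP => _; ring.
  rewrite bigA_distr; apply: eq_bigr => W _; apply: eq_bigr => x _.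
  by rewrite /F1 /G1 /F /G; case: (x \in A); case: (x \in W).
have KW W (l : {ffun X -> R}) :
    \sum_A K W A * weight l A = s * (Xp_mass q W * weight l W).
  transitivity (\sum_x l x * \sum_(A : {set X} | x \in A) K W A).
    rewrite (eq_bigr (fun A : {set X} =>
        \sum_x (if x \in A then K W A * l x else 0))).
      rewrite exchange_big /=; apply: eq_bigr => x _.
      by rewrite -big_mkcond mulr_sumr; apply: eq_bigr => A _; rewrite mulrC.
    by move=> A _; rewrite /weight mulr_sumr big_mkcond.
  rewrite /weight !mulr_sumr [RHS]big_mkcond /=; apply: eq_bigr => x _.
  rewrite sum_prod_setI {1}/F; case: ifPn => xW; last by rewrite mul0r mulr0.
  rewrite /Xp_mass [in RHS](bigD1 x) //= xW.
  rewrite (eq_bigr (fun y => if y \in W then q else 1 - q)); first by ring.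
  by move=> y _; rewrite /F /G; case: ifP => _; ring.
rewrite [leRHS](eq_bigr (fun A => \sum_W K W A * f A)); last first.
  by move=> A _; rewrite KA mulr_suml.
rewrite exchange_big /= mulr_sumr; apply: ler_sum => W _.
have [l lf gl] := H W.
apply: (@le_trans _ _ (s * (Xp_mass q W * weight l W))).
  by rewrite ler_wpM2l // ler_wpM2l // Xp_mass_ge0.
by rewrite -KW; apply: ler_sum => A _; rewrite ler_wpM2l.
Qed.

(** On [T] the factor [1 - q] becomes [q], and [(1 - q) * q <= q]. *)
Lemma Xp_mass_setU (R : realType) (X : finType) (q : R) (W T : {set X}) :
  0 <= q -> q <= 1 -> [disjoint T & W] ->
  Xp_mass q W * q ^+ #|T| <= Xp_mass q (W :|: T).
Proof.
move=> q0 q1 dTW.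
rewrite -prodr_const [X in _ * X]big_mkcond /Xp_mass -big_split /=.
apply: ler_prod => x _; rewrite finset.in_setU.
case: (boolP (x \in T)) => xT; last first.
  by rewrite mulr1 orbF lexx andbT; case: ifP; rewrite // subr_ge0.
rewrite (disjointFr dTW xT) /= mulr_ge0 ?subr_ge0 //=.
by rewrite ler_piMl // lerBlDr lerDl.
Qed.

(** Adjoining [T] is injective on sets disjoint from [T], with inverse [Z :\: T]. *)
Lemma sum_setU_le (R : realDomainType) (X : finType) (T : {set X})
    (h : {set X} -> R) :
  (forall Z, 0 <= h Z) ->
  \sum_(W : {set X} | [disjoint T & W]) h (W :|: T) <= \sum_Z h Z.
Proof.
move=> h0.
rewrite (reindex_onto (fun Z => Z :\: T) (fun W => W :|: T)); last first.
  move=> W dTW; rewrite finset.setDUl finset.setDv finset.setU0.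
  by apply/finset.setDidPl; rewrite disjoint_sym.
rewrite big_mkcond; apply: ler_sum => Z _.
by case: ifP => // /andP[_ /eqP ->].
Qed.

(** * Bounding the probability that nothing is captured *)

(** Size [t] contributes at most [4^t a^t <= 3^-t], and the geometric series from [t = 1] sums to
    1/2. *)
Lemma sum_small_subsets (R : realFieldType) (X : finType) (a : R)
    (D : nat -> {set X}) :
  0 <= a -> 12 * a <= 1 -> (forall t, #|D t| <= t.*2)%N ->
  \sum_(T : {set X} | (T != finset.set0) && (T \subset D #|T|)) a ^+ #|T| <=
    2^-1.
Proof.
move=> a0 a12 cD.
rewrite (partition_big (fun T : {set X} => inord #|T| : 'I_#|X|.+1)
  (fun t => (0 < t)%N)) /=; last first.
  move=> T /andP[T0 _]; rewrite inordK ?ltnS ?max_card //.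
  by rewrite lt0n cards_eq0.
apply: (@le_trans _ _ (\sum_(t < #|X|.+1 | (0 < t)%N) (3^-1) ^+ t)).
  apply: ler_sum => t t0.
  apply: (@le_trans _ _ (\sum_(T in powerset (D t)) a ^+ t)).
    rewrite [leLHS]big_mkcond [leRHS]big_mkcond /=; apply: ler_sum => T _.
    case: ifP => [/andP[/andP[_ TD] /eqP tT]|_]; last first.
      by case: ifP => // _; rewrite exprn_ge0.
    have <- : #|T| = t by rewrite -tT inordK // ltnS max_card.
    by rewrite powersetE TD.
  rewrite sumr_const card_powerset -[leLHS]mulr_natl natrX.
  apply: (@le_trans _ _ (4 ^+ t * a ^+ t)).
    rewrite ler_wpM2r ?exprn_ge0 //.
    have -> : 4 = 2 ^+ 2 :> R by rewrite -natrX.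
    by rewrite -exprM mul2n ler_eXn2l ?ltr1n.
  by rewrite -exprMn lerXn2r ?nnegrE ?mulr_ge0 //; lra.
rewrite big_mkcond big_ord_recl /= add0r.
have : forall n, \sum_(i < n) (3^-1 : R) ^+ (bump 0 i) = 2^-1 * (1 - 3^-1 ^+ n).
  elim=> [|n IH]; first by rewrite big_ord0 expr0 subrr mulr0.
  by rewrite big_ord_recr IH /= exprS; field.
move=> ->; have : (0 : R) <= 3^-1 ^+ #|X| by rewrite exprn_ge0.
lra.
Qed.

Lemma capture_prob (R : realType) (X I : finType) (J : {set I})
    (s : I -> seq X) (p q : R) :
  0 < p -> 12 * p <= q -> q <= 1 -> (forall i, uniq (s i)) -> (0 < #|J|)%N ->
  (forall T : {set X},
     #|[set i in J | T \subset [set x in s i]]|%:R <= p ^+ #|T| * #|J|%:R) ->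
  2^-1 <= \sum_(W | [exists i in J, captures (s i) W 0]) Xp_mass q W.
Proof.
move=> p0 pq q1 us J0 spread.
have q0 : 0 < q by lra.
have mass0 (Z : {set X}) : 0 <= Xp_mass q Z by rewrite Xp_mass_ge0 // ltW.
set cap := fun W => [exists i in J, captures (s i) W 0].
suff : \sum_(W | ~~ cap W) Xp_mass q W <= 2^-1.
  have := sum_Xp_mass X q; rewrite (bigID cap) /=; lra.
pose good (T Z : {set X}) := (T != finset.set0) && (T \subset decode J s Z #|T|).
(* With [Z = W :|: T], this bounds [Xp_mass q W * p ^+ #|T|] from above, in terms of [Z] and [T]
   only. *)
pose h (T Z : {set X}) := if good T Z then Xp_mass q Z * (p / q) ^+ #|T| else 0.
have h0 T Z : 0 <= h T Z.
  by rewrite /h; case: ifP => // _; rewrite mulr_ge0 // exprn_ge0 // divr_ge0 // ltW.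
(* Double counting: every [j] in [J] contains some good [T], while spreadness lets each [T] serve at
   most [p ^+ #|T| * #|J|] indices. *)
have cover W : ~~ cap W ->
    1 <= \sum_(T : {set X} | [disjoint T & W] && good T (W :|: T)) p ^+ #|T|.
  move=> ncap.
  have J0R : 0 < #|J|%:R :> R by rewrite ltr0n.
  rewrite -(ler_pM2r J0R) mul1r mulr_suml.
  apply: (@le_trans _ _ (\sum_(T : {set X} | [disjoint T & W] && good T (W :|: T))
      #|[set i in J | T \subset [set x in s i]]|%:R)); last exact: ler_sum.
  rewrite -natr_sum ler_nat.
  under eq_bigr do rewrite -sum1_card.
  rewrite (exchange_big_dep (mem J)) /=; last by move=> T i _; rewrite inE => /andP[].
  rewrite -sum1_card; apply: leq_sum => j jJ.
  have [T [Tj dTW Td [i iJ ci]]] := fragment_exists W us jJ.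
  rewrite (bigD1 T) //= inE jJ Tj andbT dTW /good Td !andbT /=.
  (* An empty [T] would mean that [W] alone already captures a sequence. *)
  apply: contraNneq ncap => T0; apply/exists_inP; exists i => //.
  by move: ci; rewrite T0 cards0 finset.setU0.
apply: (@le_trans _ _ (\sum_(W : {set X}) \sum_(T : {set X} | [disjoint T & W])
    h T (W :|: T))).
  rewrite big_mkcond; apply: ler_sum => W _; case: ifPn => [nc|_]; last first.
    by apply: sumr_ge0.
  apply: le_trans (_ : Xp_mass q W * \sum_(T : {set X} |
    [disjoint T & W] && good T (W :|: T)) p ^+ #|T| <= _).
    by rewrite ler_peMr // cover.
  rewrite mulr_sumr big_mkcondr; apply: ler_sum => T dTW.
  rewrite /h; case: ifP => // _.
  have -> : Xp_mass q W * p ^+ #|T| = Xp_mass q W * q ^+ #|T| * (p / q) ^+ #|T|.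
    by rewrite -mulrA -exprMn [q * _]mulrC divfK ?gt_eqF.
  by rewrite ler_wpM2r ?Xp_mass_setU ?exprn_ge0 ?divr_ge0 // ltW.
rewrite (exchange_big_dep predT) //=.
apply: (@le_trans _ _ (\sum_(T : {set X}) \sum_(Z : {set X}) h T Z)).
  by apply: ler_sum => T _; apply: sum_setU_le.
apply: (@le_trans _ _ ((\sum_(Z : {set X}) Xp_mass q Z) * 2^-1)); last first.
  by rewrite sum_Xp_mass mul1r.
rewrite exchange_big mulr_suml /=; apply: ler_sum => Z _; rewrite -big_mkcond -mulr_sumr /=.
apply: ler_wpM2l => //; apply: (@sum_small_subsets _ _ _ (decode J s Z)).
- by rewrite divr_ge0 // ltW.
- by rewrite mulrA ler_pdivrMr // mul1r.
- by move=> t; apply: card_decode.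
Qed.

(** * Extracting a spread subfamily *)

(* [S] maximizes [p^-|S|] times the number of sets containing it, among the [S]
   contained in at least two of the sets. *)
Lemma spread_core (R : realFieldType) (X I : finType) (C : I -> {set X})
    (p : R) (n : nat) :
  0 < p -> p < 1 -> (0 < n)%N -> (forall i, #|C i| <= n)%N ->
  p ^- n <= #|I|%:R ->
  exists S : {set X}, (1 < #|[set i | S \subset C i]|)%N /\
    forall T : {set X},
      #|[set i in [set i | S \subset C i] | T \subset C i :\: S]|%:R <=
      p ^+ #|T| * #|[set i | S \subset C i]|%:R.
Proof.
move=> p0 p1 n0 Cn In.
pose m (S : {set X}) := #|[set i | S \subset C i]|.
have m0 : m finset.set0 = #|I|.
  by rewrite /m -cardsT; apply: eq_card => i; rewrite !inE finset.sub0set.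
have m0_gt1 : (1 < m finset.set0)%N.
  rewrite m0 -(ltr1n R); apply: lt_le_trans In.
  by rewrite invf_gt1 ?exprn_gt0 // exprn_ilt1 -?lt0n // ltW.
have [S mS maxS] := @arg_maxP _ _ _ _ (fun S => 1 < m S)%N
  (fun S => (m S)%:R * p ^- #|S|) m0_gt1.
exists S; split=> // T.
set mT := #|_|; rewrite -[X in _ * X%:R]/(m S).
have [->|mT0] := posnP mT.
  by rewrite mulr_ge0 ?exprn_ge0 // ltW.
have [i0] : exists i, i \in [set i in [set i | S \subset C i] | T \subset C i :\: S].
  by apply/set0Pn; rewrite -card_gt0.
rewrite !inE finset.subsetD => /and3P[Si0 Ti0 dTS].
have cU : #|T :|: S| = (#|T| + #|S|)%N.
  by rewrite cardsU disjoint_setI0 // cards0 subn0.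
have mTE : mT = m (T :|: S).
  apply: eq_card => i; rewrite !inE finset.subsetD dTS andbT finset.subUset.
  by rewrite andbC.
have pS k : 0 < p ^+ k by rewrite exprn_gt0.
rewrite -(ler_pM2r (_ : 0 < p ^- (#|T| + #|S|))) ?invr_gt0 //.
have -> : p ^+ #|T| * (m S)%:R * p ^- (#|T| + #|S|) = (m S)%:R * p ^- #|S|.
  by rewrite exprD; field; rewrite !gt_eqF.
have [mT1|mT1] := ltnP 1 mT.
  by rewrite mTE -cU; apply: maxS; rewrite -mTE.
(* [T :|: S] lies in one set only and is no competitor. Instead, comparing [S] with the empty set
   gives at least [p ^- n], and [T :|: S] has at most [n] points. *)
have -> : mT = 1%N by lia.
apply: le_trans (_ : p ^- n <= _); last first.
  apply: le_trans In _; have := maxS finset.set0 m0_gt1.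
  by rewrite m0 cards0 expr0 invr1 mulr1.
rewrite mul1r lef_pV2 ?posrE //; apply: ler_wiXn2l; rewrite ?(ltW p0) ?(ltW p1) //.
rewrite -cU; apply: leq_trans (Cn i0); apply: subset_leq_card.
by rewrite finset.subUset Ti0 Si0.
Qed.

(** * Lower bound for the expected supremum *)

Theorem corollary1p11 (R : realType) :
  exists2 c : R, 0 < c &
    forall (X : finType) (p : R) (n : nat) (r : R)
      (Lambda : set {ffun X -> R}) (Lambda0 : {fset {ffun X -> R}})
      (C : {ffun X -> R} -> {set X}),
    0 < p -> p < 1 -> (0 < n)%N -> 0 < r ->
    (forall l, Lambda l -> forall x, 0 <= l x) ->
    (forall l, l \in Lambda0 -> Lambda l) ->
    (forall l, l \in Lambda0 -> (#|C l| <= n)%N) ->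
    p ^- n <= #|` Lambda0|%:R ->
    (forall l l', l \in Lambda0 -> l' \in Lambda0 -> l != l' ->
      r <= weight l (C l :\: C l')) ->
    ((c * r)%:E <= Xp_expectation p (Z Lambda))%E.
Proof.
(* [48 = 12 * 2 * 2]: thinning ratio, capture probability, half of the weight. *)
exists 48^-1 => [|X p n r Lambda Lambda0 C p0 p1 n0 r0 Lge0 L0 Cn pn sep].
  by rewrite invr_gt0.
have weight_mono (l : {ffun X -> R}) (A B : {set X}) :
    (forall x, 0 <= l x) -> A \subset B -> weight l A <= weight l B.
  move=> l0 /fintype.subsetP AB; rewrite /weight big_mkcond [leRHS]big_mkcond /=.
  by apply: ler_sum => x _; case: ifPn => [/AB -> //|_]; case: ifP.
have l0 (i : Lambda0) x : 0 <= val i x by apply/Lge0/L0/valP.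
have [||S [J1 spread]] := @spread_core R X Lambda0 (fun i => C (val i)) p n p0 p1 n0.
- by move=> i; apply/Cn/valP.
- by rewrite -cardfE.
set J := [set i | _] in J1 spread.
pose D (i : Lambda0) := C (val i) :\: S.
(* Another [i'] in [J] exists, and [S] lies in its set, so [D i] contains the separated
   difference. *)
have wD i : i \in J -> r <= weight (val i) (D i).
  move=> iJ.
  have [i' i'J ii'] : exists2 i', i' \in J & i' != i.
    have /card_gt0P[i'] : (0 < #|J :\ i|)%N by move: J1; rewrite (cardsD1 i) iJ.
    by rewrite !inE => /andP[ii' i'J]; exists i'; rewrite ?inE.
  have : r <= weight (val i) (C (val i) :\: C (val i')).
    by apply: sep; rewrite ?val_eqE 1?eq_sym //; apply: valP.
  move=> /le_trans; apply.
  apply: weight_mono => //; apply: finset.setDS.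
  by move: i'J; rewrite inE.
pose s (i : Lambda0) := sort (fun x y => val i y <= val i x) (enum (D i)).
have us i : uniq (s i) by rewrite sort_uniq enum_uniq.
have sD i : [set x in s i] = D i.
  by apply/finset.setP => x; rewrite inE mem_sort mem_enum.
have ps (i : Lambda0) : pairwise (fun x y => val i y <= val i x) (s i).
  rewrite -sorted_pairwise; last by move=> x y z /= h1 h2; apply: le_trans h1.
  by apply: sort_sorted => x y; apply: le_total.
have [i1 i1J] : exists i, i \in J by apply/card_gt0P/ltnW.
(* A real-valued minorant of [Z], which may be infinite. The default 0 is harmless because weights
   are nonnegative. *)
pose f (A : {set X}) := \big[Num.max/0]_(i : Lambda0) weight (val i) A.
have f_ge (i : Lambda0) A : weight (val i) A <= f A.
  exact: (@le_bigmax _ _ _ 0 (fun i : Lambda0 => weight (val i) A)).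
have Z_ge (i : Lambda0) A : ((weight (val i) A)%:E <= Z Lambda A)%E.
  by apply: ereal_sup_ubound; exists (val i) => //; apply/L0/valP.
have f_le A : ((f A)%:E <= Z Lambda A)%E.
  rewrite /f; elim/big_ind: _ => [|x y hx hy|i _]; last exact: Z_ge.
    apply: le_trans (Z_ge i1 A); rewrite lee_fin; apply: sumr_ge0 => x _.
    exact: l0.
  by rewrite /Num.max; case: ifP.
apply: (@le_trans _ _ (\sum_(A : {set X}) Xp_mass p A * f A)%:E); last first.
  rewrite /Xp_expectation -sumEFin; apply: lee_sum => A _.
  by rewrite EFinM; apply: lee_wpmul2l => //; rewrite lee_fin Xp_mass_ge0 // ltW.
rewrite lee_fin.
(* If [12 * p > 1], thin the full set ([q = 1]) instead: this yields [p * r >= r / 48]. *)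
have [q12|q12] := leP (12 * p) 1; last first.
  have := @thinning R X 1 p f (fun W => if W == [set: X]%SET then r else 0).
  rewrite ler01 lexx (ltW p0) (ltW p1) mul1r => /(_ isT isT isT isT) H.
  apply: le_trans (H _); last first.
    move=> W; exists (val i1) => //; case: eqP => [->|_].
      by apply: le_trans (wD _ i1J) (weight_mono _ _ _ _ (finset.subsetT _)).
    by apply: sumr_ge0 => x _; apply: l0.
  rewrite (bigD1 [set: X]%SET) //= eqxx big1 ?addr0; last first.
    by move=> W /negbTE ->; rewrite mulr0.
  rewrite /Xp_mass big1 ?mul1r; last by move=> x _; rewrite inE.
  by rewrite ler_wpM2r ?(ltW r0) //; lra.
pose g (W : {set X}) := if [exists i in J, captures (s i) W 0] then r / 2 else 0.
have := @thinning R X (12 * p) 12^-1 f g.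
have -> : 12 * p * 12^-1 = p by field.
have -> : 0 <= 12 * p by lra.
rewrite q12 => H.
apply: le_trans (H isT isT _ _ _); [|lra|lra|]; last first.
  move=> W; rewrite /g; case: ifP => [/exists_inP[i iJ ci]|_].
    exists (val i) => //.
    have := captures0_weight (l0 i) (us i) (ps i) ci.
    by rewrite sD; have := wD i iJ; lra.
  by exists (val i1) => //; apply: sumr_ge0 => x _; apply: l0.
have prob : 2^-1 <= \sum_(W | [exists i in J, captures (s i) W 0]) Xp_mass (12 * p) W.
  apply: (capture_prob p0) => //; first exact: ltnW.
  move=> T; rewrite (eq_card (B := [set i in J | T \subset D i])) ?spread //.
  by move=> i; rewrite !inE sD.
have -> : \sum_W Xp_mass (12 * p) W * g W =
    (\sum_(W | [exists i in J, captures (s i) W 0]) Xp_mass (12 * p) W) * (r / 2).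
  rewrite mulr_suml [RHS]big_mkcond; apply: eq_bigr => W _.
  by rewrite /g; case: ifP => // _; rewrite mulr0.
have := ler_wpM2r (ltW r0) prob; lra.
Qed.
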